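(* Let $q$ be a prime power, and let $k,t,n$ be integers with $k>t\geq 1$ and $n\geq 2t(k-t+1)+k+1$. Then $$\operatorname{tw}(K_q(n,k,t))={n\brack k}-{n-t\brack k-t}-1.$$
   Context: Let $V$ be an $n$-dimensional vector space over the finite field $\mathbb{F}_q$. For integers $a,b\ge 1$ the Gaussian binomial coefficient is ${a\brack b}=\prod_{0\le i<b}\frac{q^{a-i}-1}{q^{b-i}-1}$, with ${a\brack 0}=1$ and ${a\brack c}=0$ for $c<0$; ${n\brack k}$ is the number of $k$-dimensional subspaces of $V$. The generalized $q$-Kneser graph $K_q(n,k,t)$ is the graph whose vertices are the $k$-dimensional subspaces of $V$, two distinct vertices $F_1,F_2$ being adjacent iff $\dim(F_1\cap F_2)<t$. A tree decomposition of a graph $G$ is a pair $(T,(V_s)_{s\in V(T)})$ where $T$ is a tree and $V_s\subseteq V(G)$ such that (i) $\bigcup_s V_s=V(G)$, (ii) every edge of $G$ has both ends in some $V_s$, (iii) for each $v\in V(G)$ the set $\{s: v\in V_s\}$ induces a connected subgraph of $T$. Its width is $\max_s|V_s|-1$, and the treewidth $\operatorname{tw}(G)$ is the minimum width over all tree decompositions of $G$. *)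

(* Defs.v *)
From HB Require Import structures.
From mathcomp Require Import all_boot all_order all_algebra.
From mathcomp Require Import boolp.

Set Implicit Arguments.
Unset Strict Implicit.
Unset Printing Implicit Defensive.

Import Order.TTheory GRing.Theory Num.Theory.
Local Open Scope ring_scope.

Record sgraph := SGraph {
  vertex :> finType;
  adj : rel vertex;
  adj_sym : symmetric adj;
  adj_irr : irreflexive adj }.

(* [ucycle] also accepts the degenerate closed walks [:: x; y] along an edge,
   so acyclicity only forbids simple cycles with at least three vertices. *)
Definition is_tree (T : sgraph) : Prop :=
  [/\ (0 < #|T|)%N,
      forall x y : T, connect (@adj T) x y
    & forall c : seq T, ucycle (@adj T) c -> (size c < 3)%N].

Definition induces_connected (T : sgraph) (A : {set T}) : Prop :=
  {in A &, forall s s' : T,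
    connect [rel a b : T | [&& adj a b, a \in A & b \in A]] s s'}.

Record tree_decomposition (G : sgraph) := TreeDecomposition {
  td_tree : sgraph;
  td_bag : td_tree -> {set G};
  td_is_tree : is_tree td_tree;
  td_cover : \bigcup_(s : td_tree) td_bag s = [set: G];
  td_edge : forall x y : G, adj x y ->
    exists s : td_tree, (x \in td_bag s) && (y \in td_bag s);
  td_conn : forall v : G,
    induces_connected [set s : td_tree | v \in td_bag s] }.

(* Integer-valued: the width is -1 when all bags are empty. *)
Definition width (G : sgraph) (D : tree_decomposition G) : int :=
  (\max_(s : td_tree D) #|td_bag s|)%N%:Z - 1.

Section Treewidth.
Variable G : sgraph.

Definition trivial_tree : sgraph :=
  @SGraph unit (fun _ _ => false) (fun _ _ => erefl) (fun _ => erefl).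

Lemma trivial_treeP : is_tree trivial_tree.
Proof.
split; first by rewrite card_unit.
  by move=> [] []; apply: connect0.
by case=> [|x [|y c]] //= /andP[].
Qed.

Lemma trivial_cover : \bigcup_(s : trivial_tree) [set: G] = [set: G].
Proof. by apply/setP=> x; rewrite inE; apply/bigcupP; exists tt. Qed.

Lemma trivial_edge (x y : G) : adj x y ->
  exists s : trivial_tree, (x \in [set: G]) && (y \in [set: G]).
Proof. by exists tt; rewrite !inE. Qed.

Lemma trivial_conn (v : G) :
  induces_connected [set s : trivial_tree | v \in [set: G]].
Proof. by move=> [] [] _ _; apply: connect0. Qed.

Definition trivial_td : tree_decomposition G :=
  @TreeDecomposition G trivial_tree (fun=> [set: G]) trivial_treeP
    trivial_cover trivial_edge trivial_conn.

Definition has_width_pred (m : nat) : Prop :=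
  exists D : tree_decomposition G, width D = m%:Z - 1.

Lemma ex_width : exists m, `[< has_width_pred m >].
Proof.
exists (\max_(s : td_tree trivial_td) #|td_bag s|)%N.
by apply/asboolP; exists trivial_td.
Qed.

(* All widths are at least -1, so the minimum is taken over width + 1. *)
Definition treewidth : int := (ex_minn ex_width)%:Z - 1.

Lemma treewidthP :
  (exists D : tree_decomposition G, width D = treewidth) /\
  (forall D : tree_decomposition G, treewidth <= width D).
Proof.
rewrite /treewidth; case: ex_minnP => m /asboolP mP m_min; split=> // D.
by rewrite lerD2r lez_nat; apply: m_min; apply/asboolP; exists D.
Qed.

End Treewidth.

(* The subtype structure of [{vspace V}] over matrices is only available
   through this module. *)
Section FiniteSubspaces.
Import VectorInternalTheory.

Variables (F : finFieldType) (V : vectType F).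

HB.instance Definition _ := [Countable of {vspace V} by <:].
HB.instance Definition _ := [Finite of {vspace V} by <:].

End FiniteSubspaces.

Section QKneser.
Variables (F : finFieldType) (V : vectType F) (k t : nat).

Definition qkneser_vertex : finType := {U : {vspace V} | \dim U == k}.

Definition qkneser_adj : rel qkneser_vertex := fun U W =>
  (U != W) && (\dim (val U :&: val W) < t)%N.

Lemma qkneser_sym : symmetric qkneser_adj.
Proof. by move=> U W; rewrite /qkneser_adj eq_sym capvC. Qed.

Lemma qkneser_irr : irreflexive qkneser_adj.
Proof. by move=> U; rewrite /qkneser_adj eqxx. Qed.

Definition qkneser : sgraph := SGraph qkneser_sym qkneser_irr.

End QKneser.

(* For [a < b] the factor [i = a] is 0, so truncation of [a - i] is harmless;
   [b - i] is always positive. *)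
Definition gauss_binom (q a b : nat) : rat :=
  \prod_(i < b) (((q ^ (a - i))%N%:R - 1) / ((q ^ (b - i))%N%:R - 1)).

(* Main.v *)
(* Upper bound: the k-spaces containing a fixed t-space form an independent set
   I with [n-t, k-t]_q elements, and G has a tree decomposition over a star
   with centre bag V(G) \ I and leaf bags N[v] for v in I.

   Lower bound: put m = [n-t, k-t]_q. If two disjoint sets A and B of k-spaces
   have no edge between them and m < |A| + |B|, then one of them has at most m/4
   elements: if |A| > m/2, counting shows that all of B contains a common
   t-space U, not all of A does, and then the members of B, all of which meet
   some a not containing U in dimension at least t, are few. In a tree
   decomposition whose bags all miss more than m vertices, for every node s
   exactly one branch of the tree at s would thus carry almost all vertices
   outside the bag of s; following the large branches ends at an edge of the tree
   whose two sides are both large, a contradiction. *)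
Require Import Defs.
From mathcomp Require Import all_boot all_order all_algebra all_field zify.
Import Order.TTheory GRing.Theory Num.Theory.
Local Open Scope ring_scope.

Set Implicit Arguments.
Unset Strict Implicit.
Unset Printing Implicit Defensive.

(** * Branches of a tree: the components left when one node is deleted *)

Definition avoid {T : sgraph} (s : T) : rel T :=
  fun a b => [&& adj a b, a != s & b != s].

Lemma avoid_connect_sym (T : sgraph) (s : T) : connect_sym (avoid s).
Proof.
by apply: sym_connect_sym => a b; rewrite /avoid adj_sym (andbC (a != s)).
Qed.

Lemma connect_avoid_neq (T : sgraph) (s x y : T) :
  connect (avoid s) x y -> x != s -> y != s.
Proof.
case/connectP=> p; elim: p x => [|z p IHp] x /=; first by move=> _ ->.
by case/andP=> /and3P[_ _ zs] zp yE _; apply: IHp zs.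
Qed.

(** A path without repetition never returns to its start [s], so after the first step it stays
    inside one branch. *)
Lemma connect_avoid_nbr (T : sgraph) (s y : T) :
  connect (@adj T) s y -> y != s ->
  exists2 s', adj s s' & connect (avoid s) s' y.
Proof.
case/connectP=> p0 /shortenP[p sp] /= /andP[sNp _ _] ->{y p0}.
case: p sp sNp => [|s' p] /=; first by rewrite eqxx.
case/andP=> ss' s'p sNp _; exists s' => //.
apply/connectP; exists p => //.
elim: p s' s'p sNp {ss'} => //= z p IHp s' /andP[s'z zp].
rewrite !inE !negb_or => /and3P[ss' sz sNp]; rewrite /avoid.
by rewrite (eq_sym s') (eq_sym z) s'z ss' sz IHp // !inE negb_or sz.
Qed.

(** Otherwise [s'] and [s] would be joined through [y] without using the edge between them, and that
    edge would close a cycle. *)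
Lemma tree_edge_separates (T : sgraph) (s s' y : T) :
  is_tree T -> adj s s' ->
  connect (avoid s) s' y -> connect (avoid s') s y -> False.
Proof.
case=> _ _ acyclT ss' s'y sy.
have sNs' : s != s' by apply: contraTneq ss' => ->; rewrite adj_irr.
pose e := [rel a b : T |
  adj a b && ~~ ((a == s) && (b == s') || (a == s') && (b == s))].
have e_sym : connect_sym e.
  apply: sym_connect_sym => a b /=; rewrite adj_sym orbC (andbC (a == s)).
  by rewrite (andbC (a == s')).
have se z u v : (z == s) || (z == s') -> connect (avoid z) u v -> connect e u v.
  move=> zss'; apply: connect_sub => a b /and3P[ab az bz]; apply: connect1.
  by rewrite /= ab /=; case/orP: zss' => /eqP <-; rewrite (negPf az) (negPf bz) ?andbF.
have: connect e s' s.
  apply: (connect_trans (y := y)); first by apply: (se s) => //; rewrite eqxx.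
  by rewrite e_sym; apply: (se s') => //; rewrite eqxx orbT.
case/connectP=> p0 /shortenP[p s'p upp _] lastp {p0}.
have /acyclT : ucycle (@adj T) (s' :: p).
  rewrite /ucycle upp andbT /= rcons_path -lastp ss' andbT.
  by apply: sub_path s'p => a b /andP[].
(* The short paths are impossible: length 0 gives [s = s'], and length 1 is the deleted edge. *)
case: p s'p lastp {upp} => [|a [|b p]] //=.
  by move=> _ E; rewrite E eqxx in sNs'.
by move=> /andP[+ _] E; rewrite -E !eqxx orbT andbF.
Qed.

(** * Large bags, for graphs in which sets with no edge between them are unbalanced *)

Section LargeBag.
Variables (G : sgraph) (D : tree_decomposition G) (m : nat).
Hypothesis unbalanced : forall A B : {set G},
  [disjoint A & B] -> {in A & B, forall x y, ~~ adj x y} ->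
  (m < #|A| + #|B|)%N -> (4 * #|A| <= m)%N || (4 * #|B| <= m)%N.

Let T := td_tree D.

(* The vertices outside the bag of [s] living in the branches at [s] that meet
   [Y]; by [beyondP], one bag node decides for all of them. *)
Definition beyond (s : T) (Y : {set T}) : {set G} :=
  [set v | v \notin td_bag s &
           [exists x, (v \in td_bag x) && [exists y in Y, connect (avoid s) y x]]].

Lemma connect_bags (s x y : T) (v : G) :
  v \notin td_bag s -> v \in td_bag x -> v \in td_bag y -> connect (avoid s) x y.
Proof.
move=> vs vx vy; have := @td_conn _ D v x y; rewrite !inE => /(_ vx vy).
apply: connect_sub => a b /=; rewrite !inE => /and3P[ab va vb].
by apply: connect1; rewrite /avoid ab /=; apply/andP; split; apply: contraNneq vs => <-.
Qed.

Lemma beyondP (s : T) (Y : {set T}) (v : G) (x : T) :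
  v \in beyond s Y -> v \in td_bag x -> exists2 y, y \in Y & connect (avoid s) y x.
Proof.
rewrite inE => /andP[vs /existsP[z /andP[vz /exists_inP[y yY yz]]]] vx.
by exists y => //; apply: connect_trans yz (connect_bags vs vz vx).
Qed.

Lemma exists_bag (v : G) : exists s : T, v \in td_bag s.
Proof. by have := in_setT v; rewrite -(td_cover D) => /bigcupP[s _]; exists s. Qed.

(** The ends of an edge leaving [beyond s Y] share a bag, whose node lies in a branch meeting [Y] by
    [beyondP]; so the other end is in [beyond s Y] or in the bag of [s]. *)
Lemma beyond_halves (s : T) (Y : {set T}) :
  (m < #|~: td_bag s|)%N -> 
  (4 * #|beyond s Y| <= m)%N || (4 * #|~: td_bag s :\: beyond s Y| <= m)%N.
Proof.
have sub : beyond s Y \subset ~: td_bag s.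
  by apply/subsetP=> v; rewrite !inE => /andP[].
move=> ms; apply: unbalanced.
- by rewrite -setI_eq0 setIDA (setIidPl sub) setDv.
- move=> u v uY; rewrite !inE => /andP[vY vs]; rewrite vs /= in vY.
  apply: contra vY => /(@td_edge _ D)[x /andP[ux vx]]; apply/existsP; exists x.
  by rewrite vx; have [y yY yx] := beyondP uY ux; apply/exists_inP; exists y.
- by rewrite cardsD (setIidPr sub) subnKC ?subset_leq_card.
Qed.

Lemma beyondU (s : T) (Y Z : {set T}) :
  beyond s (Y :|: Z) \subset beyond s Y :|: beyond s Z.
Proof.
apply/subsetP=> v; rewrite !inE => /andP[-> /existsP[x /andP[vx]]].
case/exists_inP=> y; rewrite !inE => /orP[] yY yx; apply/orP; [left|right];
  by apply/existsP; exists x; rewrite vx; apply/exists_inP; exists y.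
Qed.

(** By [beyond_halves], a set [beyond s Z] of size at most m/2 has size at most m/4. If a minimal
    [Y] above m/2 were a point and a rest, both at most m/4, it could not exceed m/2. *)
Lemma exists_big_branch (s : T) :
  (m < #|~: td_bag s|)%N -> exists y, (m < 2 * #|beyond s [set y]|)%N.
Proof.
move=> ms; pose P (Y : {set T}) := (m < 2 * #|beyond s Y|)%N.
have PT : P setT.
  suff /subset_leq_card le : ~: td_bag s \subset beyond s setT by rewrite /P; lia.
  apply/subsetP=> v; rewrite !inE => -> /=; have [x vx] := exists_bag v.
  by apply/existsP; exists x; rewrite vx; apply/exists_inP; exists x.
have [Y /minsetP[PY minY] _] := minset_exists PT.
have [Y0|[y yY]] := set_0Vmem Y.
  suff E : beyond s Y = set0 by move: PY; rewrite /P E cards0.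
  apply/setP=> v; rewrite !inE Y0; apply/negP=> /andP[_ /existsP[x /andP[_]]].
  by case/exists_inP=> z; rewrite inE.
exists y; rewrite ltnNge; apply/negP => ley.
have small Z : ~~ P Z -> (4 * #|beyond s Z| <= m)%N.
  rewrite /P -leqNgt => leZ; have /orP[//|] := beyond_halves Z ms.
  have sub : beyond s Z \subset ~: td_bag s.
    by apply/subsetP=> v; rewrite !inE => /andP[].
  by rewrite cardsD (setIidPr sub); lia.
have lt1 : (4 * #|beyond s (Y :\ y)| <= m)%N.
  apply: small; apply/negP=> PY'; have := minY _ PY' (subD1set _ _).
  by move/setP/(_ y); rewrite !inE eqxx yY.
have lt2 : (4 * #|beyond s [set y]| <= m)%N by apply: small; rewrite /P -leqNgt.
have := subset_leq_card (beyondU s [set y] (Y :\ y)); rewrite setD1K //.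
move/leq_trans/(_ (leq_card_setU _ _)); move: PY; rewrite /P; lia.
Qed.

(* [K s] is the large branch at [s]. If [K s] is smallest possible and [s'] is the
   neighbour of [s] in [K s], then [K s'] contains [s], so the two large branches
   lie on opposite sides of the edge from [s] to [s']. *)
Lemma exists_large_bag : exists s : T, (#|G| - m <= #|td_bag s|)%N.
Proof.
have [T0 Tconn _] := td_is_tree D.
suff: [exists s : T, (#|~: td_bag s| <= m)%N].
  case/existsP=> s sm; exists s; have := cardsC (td_bag s); lia.
apply: contraT; rewrite negb_exists => /forallP ltm.
have big (s : T) : exists y : T, (m < 2 * #|beyond s [set y]|)%N.
  by apply: exists_big_branch; rewrite ltnNge ltm.
have /fin_all_exists[f fP] := big.
have /card_gt0P[s0 _] := T0.
pose K s := [set y | connect (avoid s) (f s) y].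
case: (arg_minnP (fun s => #|K s|) (isT : predT s0)) => s _ Kmin.
(* The node [z] is isolated for [avoid z], so nothing is beyond [z] in its own class. *)
have fNs z : f z != z.
  apply/eqP=> fz; suff B0 : beyond z [set f z] = set0 by have := fP z; rewrite B0 cards0.
  apply/setP=> v; rewrite in_set0; apply/negP=> vz; have [x vx] := exists_bag v.
  have [_ /set1P->] := beyondP vz vx; rewrite fz => zx.
  move: vz; rewrite inE => /andP[/negP[]].
  have [<- //|xz] := eqVneq x z.
  by rewrite avoid_connect_sym in zx; have := connect_avoid_neq zx xz; rewrite eqxx.
have [s' ss' s'f] := connect_avoid_nbr (Tconn s (f s)) (fNs s).
have sNs' : s != s' by apply: contraTneq ss' => ->; rewrite adj_irr.
have [t s't tf] := connect_avoid_nbr (Tconn s' (f s')) (fNs s').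
have KsE y : (y \in K s) = connect (avoid s) s' y.
  by rewrite inE (same_connect (@avoid_connect_sym _ s) s'f).
have [sK|sK] := boolP (s \in K s').
  have sep u (x : T) : u \in beyond s [set f s] -> u \in td_bag x ->
      ~ exists2 v, v \in beyond s' [set f s'] & v \in td_bag x.
    move=> us ux [v vs' vx].
    have [_ /set1P-> fx] := beyondP us ux; have [_ /set1P-> f'x] := beyondP vs' vx.
    apply: (tree_edge_separates (y := x) (td_is_tree D) ss').
      exact: connect_trans s'f fx.
    by rewrite inE avoid_connect_sym in sK; apply: connect_trans sK f'x.
  have := fP s; have := fP s'.
  set A := beyond s _ in sep *; set B := beyond s' _ in sep *.
  move=> ltB ltA; suff: (4 * #|A| <= m)%N || (4 * #|B| <= m)%N by lia.
  apply: unbalanced; last by lia.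
    rewrite disjoints_subset; apply/subsetP=> u uA; rewrite inE; apply/negP=> uB.
    by have [x ux] := exists_bag u; apply: (sep u x) => //; exists u.
  move=> u v uA vB; apply/negP=> /(@td_edge _ D)[x /andP[ux vx]].
  by apply: (sep u x) => //; exists v.
(* If [K s'] misses [s], it lies inside [K s] and omits [s'], against minimality. *)
suff: K s' \proper K s by move/proper_card; rewrite ltnNge Kmin.
have tNs : t != s.
  by apply: contraNneq sK => <-; rewrite inE avoid_connect_sym.
apply/properP; split; last first.
  exists s'; first by rewrite KsE connect0.
  rewrite inE; apply/negP; move/connect_avoid_neq/(_ (fNs s')); by rewrite eqxx.
apply/subsetP=> y; rewrite KsE inE -(same_connect (@avoid_connect_sym _ s') tf).
move=> ty.
apply: (@connect_trans _ _ t).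
  by apply: connect1; rewrite /avoid s't tNs eq_sym sNs'.
(* A path inside [K s'] cannot reach [s], so it is also a path for [avoid s]. *)
have tNcs : ~~ connect (avoid s') t s.
  by rewrite (same_connect (@avoid_connect_sym _ s') tf); rewrite inE in sK.
case/connectP: ty => p tp ->.
apply/connectP; exists p => //.
elim: p t tp tNs tNcs {s't tf} => //= a p IHp t /andP[ta ap] tNs tNcs.
have aNcs : ~~ connect (avoid s') a s.
  by apply: contra tNcs; apply: connect_trans (connect1 _).
have aNs : a != s by apply: contraNneq aNcs => ->.
by case/and3P: ta => ta _ _; rewrite /avoid ta tNs aNs IHp.
Qed.

End LargeBag.

(** * The star decomposition given by an independent set *)

Section StarDecomposition.
Variables (G : sgraph) (I : {set G}).
Hypothesis indepI : {in I &, forall x y : G, ~~ adj x y}.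

Definition star_adj : rel (option G) := fun a b => isSome a != isSome b.

Lemma star_sym : symmetric star_adj.
Proof. by move=> a b; rewrite /star_adj eq_sym. Qed.

Lemma star_irr : irreflexive star_adj.
Proof. by move=> a; rewrite /star_adj eqxx. Qed.

Definition star : sgraph := SGraph star_sym star_irr.

Lemma star_is_tree : is_tree star.
Proof.
have to_center (a : star) : connect (@adj star) a None.
  by case: a => [a|]; [apply: connect1 | apply: connect0].
have star_connect_sym := sym_connect_sym (@adj_sym star).
split=> [|a b|]; first by apply/card_gt0P; exists None.
  by apply: connect_trans (to_center a) _; rewrite star_connect_sym.
(* A closed walk alternates between [None] and leaves; with three nodes it breaks the alternation,
   and with more it repeats [None] among the first four. *)
case=> [|[a|] [|[b|] [|[c|] [|[d|] p]]]] //=; rewrite /ucycle /= ?inE //=.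
all: by rewrite ?andbF.
Qed.

(** Leaves are indexed by all of [G] to avoid a subtype; those outside [I] get an empty bag. *)
Definition star_bag (a : star) : {set G} :=
  if a is Some v then
    if v \in I then v |: [set w | adj v w] else set0
  else ~: I.

Lemma star_cover : \bigcup_(a : star) star_bag a = [set: G].
Proof.
apply/setP=> v; rewrite inE; apply/bigcupP.
have [vI|vI] := boolP (v \in I); last by exists None => //; rewrite inE.
by exists (Some v) => //; rewrite /= vI setU11.
Qed.

Lemma star_edge (x y : G) : adj x y ->
  exists a : star, (x \in star_bag a) && (y \in star_bag a).
Proof.
move=> xy; have [xI|xI] := boolP (x \in I).
  by exists (Some x); rewrite /= xI !inE eqxx xy /= ?orbT.
have [yI|yI] := boolP (y \in I); last by exists None; rewrite /= !inE xI.
by exists (Some y); rewrite /= yI !inE eqxx adj_sym xy /= ?orbT.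
Qed.

(** By independence, a vertex of [I] lies only in the bag of its own leaf; any other vertex lies in
    the centre bag. *)
Lemma star_conn (v : G) : induces_connected [set a : star | v \in star_bag a].
Proof.
set A := [set a | _]; pose e := [rel a b : star | [&& adj a b, a \in A & b \in A]].
have e_sym : connect_sym e.
  by apply: sym_connect_sym => a b; congr (_ && _); [exact: star_sym | exact: andbC].
have [vI|vI] := boolP (v \in I).
  suff AE a : a \in A -> a = Some v by move=> a b /AE-> /AE->; apply: connect0.
  rewrite inE; case: a => [u|]; rewrite /= ?inE ?vI //.
  case: ifP => uI; rewrite !inE // => /orP[/eqP->//|uv].
  by have := indepI uI vI; rewrite uv.
have NA : None \in A by rewrite !inE.
have to_center a : a \in A -> connect e a None.
  by case: a => [u|] uA; [apply: connect1; rewrite /= uA NA | apply: connect0].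
move=> a b aA bA; apply: connect_trans (to_center a aA) _.
by change (connect e None b); rewrite e_sym to_center.
Qed.

Definition star_decomposition : tree_decomposition G :=
  TreeDecomposition star_is_tree star_cover star_edge star_conn.

(** The leaf bag of [v] misses [I :\ v] and also [u], which makes up for [v]; so it is no larger
    than the centre bag. *)
Lemma treewidth_le_star :
  (forall v, v \in I -> exists2 u, u \notin I & (u != v) && ~~ adj v u) ->
  treewidth G <= (#|G| - #|I|)%N%:Z - 1.
Proof.
move=> nbrI; apply: le_trans (proj2 (treewidthP G) star_decomposition) _.
rewrite /width lerD2r lez_nat; apply/bigmax_leqP => -[v|] _ /=; last first.
  by rewrite -(cardsC I) addKn.
case: ifP => vI; last by rewrite cards0.
have [u uI /andP[uv vNu]] := nbrI v vI.
have sub : u |: (I :\ v) \subset ~: (v |: [set w | adj v w]).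
  apply/subsetP=> w; rewrite !inE negb_or => /orP[/eqP->|/andP[-> wI]].
    by rewrite uv vNu.
  exact: indepI.
have := subset_leq_card sub.
rewrite cardsU1 !inE (negPf uI) andbF /= (cardsD1 v I) vI.
have := cardsC (v |: [set w | adj v w]).
rewrite -[nat_of_bool true]/1%N => <-; lia.
Qed.

End StarDecomposition.

(** * Counting the [k]-spaces that contain a given subspace *)

Lemma gauss_binomSS (q a b : nat) :
  gauss_binom q a.+1 b.+1 =
    ((q ^ a.+1)%N%:R - 1) / ((q ^ b.+1)%N%:R - 1) * gauss_binom q a b.
Proof. by rewrite /gauss_binom big_ord_recl; under eq_bigr do rewrite /= !subSS. Qed.

Lemma gauss_binomn0 (q a : nat) : gauss_binom q a 0 = 1.
Proof. exact: big_ord0. Qed.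

Section Subspaces.
Variables (F : finFieldType) (V : vectType F).
Implicit Types U W : {vspace V}.

Lemma exists_subspace (j : nat) U :
  (j <= \dim U)%N -> exists2 W, (W <= U)%VS & \dim W = j.
Proof.
move=> jU; exists <<take j (vbasis U)>>%VS.
  by apply/span_subvP=> x /mem_take /vbasis_mem.
have /basis_free := vbasisP U; rewrite -{1}(cat_take_drop j (vbasis U)) => /catl_free.
by rewrite /free => /eqP ->; rewrite size_takel // size_tuple.
Qed.

Lemma dim_add_line U (x : V) : x \notin U -> \dim (U + <[x]>) = (\dim U).+1.
Proof.
move=> xU; rewrite dimv_disjoint_sum ?dim_vline; last first.
  apply/eqP; rewrite -subv0; apply/subvP=> y; rewrite memv_cap => /andP[yU].
  case/vlineP=> a ya; rewrite memv0; apply: contraNT xU => y0.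
  have a0 : a != 0 by apply: contraNneq y0 => a0; rewrite ya a0 scale0r.
  by rewrite -[x](scalerK a0) -ya memvZ.
by rewrite addnC (contraNneq _ xU) // => ->; apply: mem0v.
Qed.


Lemma card_subspace U : #|[set x : finvect_type V | x \in U]| = (#|F| ^ \dim U)%N.
Proof.
(* Only after destructing [V] is the vector space structure of [finvect_type V]
   convertible to that of [V]. *)
rewrite cardsE; case: V U => T [? ? ? ? ? ? ? ? ? ? ?] U.
exact: (@card_vspace F (finvect_type (Vector.Pack _))
  (Vector.class (finvect_type (Vector.Pack _)))).
Qed.

Section Containing.
Variable k : nat.

Definition containing U : {set qkneser_vertex V k} :=
  [set W | (U <= val W)%VS].

Lemma dim_vertex (W : qkneser_vertex V k) : \dim (val W) = k.
Proof. exact/eqP/(valP W). Qed.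

Lemma card_setD_subspace U W : (U <= W)%VS ->
  #|[set x : finvect_type V | (x \notin U) && (x \in W)]|
    = (#|F| ^ \dim W - #|F| ^ \dim U)%N.
Proof.
move=> UW; have sub : [set x : finvect_type V | x \in U] \subset
    [set x : finvect_type V | x \in W].
  by apply/subsetP=> x; rewrite !inE; apply: (subvP UW).
rewrite -!card_subspace -(setIidPr sub).
by rewrite -cardsD; apply: eq_card => x; rewrite !inE.
Qed.

Lemma card_subspaceC U :
  #|[pred x : finvect_type V | x \notin U]|
    = (#|F| ^ \dim {:V} - #|F| ^ \dim U)%N.
Proof.
rewrite -card_setD_subspace ?subvf // -cardsE.
by apply: eq_card => x; rewrite !inE memvf andbT.
Qed.

(** Double counting of the pairs of a vector [x] outside [U] and a [k]-space containing both [U] and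
    [x]. *)
Lemma sum_card_containing U :
  (\sum_(x : finvect_type V | x \notin U) #|containing (U + <[x : V]>)|
    = #|containing U| * (#|F| ^ k - #|F| ^ \dim U))%N.
Proof.
under eq_bigr do rewrite -sum1_card.
rewrite (exchange_big_dep (mem (containing U))) /=; last first.
  by move=> x W _; rewrite !inE subv_add => /andP[].
rewrite -sum_nat_const; apply: eq_bigr => W; rewrite inE => UW.
rewrite sum1dep_card -[X in (_ ^ X - _)%N](dim_vertex W) -card_setD_subspace //.
by apply: eq_card => x; rewrite !inE subv_add UW.
Qed.

(* Any [W] with [dim (W :&: b) >= t] meets a subspace [C] of [b] of dimension
   [k - t + 1]; choosing [C] with [C :&: U = 0] forces a line of [C] outside [U]
   into [W]. *)
Lemma card_containing_step (t c : nat) (A : {set qkneser_vertex V k}) U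
    (b : qkneser_vertex V k) :
  (t <= k)%N -> (\dim (U :&: val b) < t)%N ->
  {in A, forall a, t <= \dim (val a :&: val b)}%N ->
  (forall x : V, x \notin U -> #|A :&: containing (U + <[x]>)| <= c)%N ->
  (#|A :&: containing U| <= #|F| ^ (k - t + 1) * c)%N.
Proof.
move=> tk Ubt Ab Ac.
have [C CbU dimC] : exists2 C, (C <= val b :\: U)%VS & \dim C = (k - t + 1)%N.
  apply: exists_subspace; have := dimv_cap_compl (val b) U.
  by rewrite dim_vertex capvC; lia.
have Cb : (C <= val b)%VS := subv_trans CbU (diffvSl _ _).
have CU x : x \in C -> x != 0 -> x \notin U.
  move=> xC; apply: contra => xU; rewrite -memv0 -(capv_diff (val b) U).
  by rewrite memv_cap xU (subvP CbU).
pose X := [set x : finvect_type V | x \in C] :\ 0.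
have sub : A :&: containing U \subset \bigcup_(x in X) (A :&: containing (U + <[x : V]>)).
  apply/subsetP=> a; rewrite !inE => /andP[aA Ua].
  (* Both [val a :&: val b] and [C] lie in the [k]-space [val b], and their dimensions add up to at
     least [t + (k - t + 1) > k]. *)
  have dimaC : (0 < \dim (val a :&: C))%N.
    have := dimv_sum_cap (val a :&: val b) C.
    rewrite -capvA (capv_idPr Cb) dimC.
    have := Ab a aA; have : (\dim (val a :&: val b + C) <= k)%N.
      by rewrite -[X in (_ <= X)%N](dim_vertex b) dimvS // subv_add capvSr.
    by move: (\dim (_ + C)) (\dim (_ :&: C)) (\dim (_ :&: val b)) => u v w; lia.
  pose x := vpick (val a :&: C).
  have /memv_capP[xa xC] : x \in (val a :&: C)%VS := memv_pick _.
  have x0 : x != 0 by rewrite vpick0 -dimv_eq0 -lt0n.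
  apply/bigcupP; exists x; first by rewrite !inE x0.
  by rewrite !inE aA subv_add Ua -memvE.
apply: leq_trans (subset_leq_card sub) _.
apply: (@leq_trans (\sum_(x in X) c)%N).
  elim/big_ind2: _ => [|m B m' B' le le'|x]; first by rewrite cards0.
    exact: leq_trans (leq_card_setU _ _) (leq_add le le').
  by rewrite !inE => /andP[x0 xC]; apply: Ac; apply: CU.
rewrite sum_nat_const leq_mul2r -dimC -card_subspace; apply/orP; right.
exact: subset_leq_card (subD1set _ _).
Qed.

Hypothesis kn : (k <= \dim {:V})%N.

(** Induction on [k - \dim U]: after division by a power of [q], [sum_card_containing] is the
    recursion [gauss_binomSS]. *)
Lemma card_containing U : (\dim U <= k)%N ->
  #|containing U|%:R = gauss_binom #|F| (\dim {:V} - \dim U) (k - \dim U).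
Proof.
set n := \dim {:V}; have q1 : (1 < #|F|)%N := card_finNzRing_gt1 F.
move=> Uk; have [d dE] : exists d, (k - \dim U)%N = d by eexists.
elim: d U Uk dE => [|d IHd] U Uk dE.
  have Uk' : \dim U == k by lia.
  rewrite dE gauss_binomn0 (_ : containing U = [set Sub U Uk']) ?cards1 //.
  apply/setP=> W; rewrite !inE -val_eqE /= eq_sym eqEdim dim_vertex (eqP Uk').
  by rewrite leqnn andbT.
have qU m : (\dim U <= m)%N -> ((#|F| ^ m)%N%:R - (#|F| ^ \dim U)%N%:R : rat)
    = (#|F| ^ \dim U)%N%:R * ((#|F| ^ (m - \dim U))%N%:R - 1).
  by move=> Um; rewrite mulrBr mulr1 -natrM -expnD subnKC.
have nz m : ((#|F| ^ m.+1)%N%:R - 1 : rat) != 0.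
  by rewrite subr_eq0 pnatr_eq1 -(expn0 #|F|) eqn_exp2l.
have nzU : ((#|F| ^ \dim U)%N%:R : rat) != 0 by rewrite pnatr_eq0 expn_eq0; lia.
have nE : (n - \dim U = (n - (\dim U).+1).+1)%N by rewrite /n; lia.
have := congr1 (fun m => m%:R : rat) (sum_card_containing U).
rewrite natr_sum natrM natrB ?leq_pexp2l // 1?ltnW // qU //.
rewrite (eq_bigr (fun=> gauss_binom #|F| (n - (\dim U).+1) d)); last first.
  move=> x xU; have dimUx := dim_add_line xU.
  by rewrite IHd dimUx; [congr (gauss_binom _ _ _); lia | lia | lia].
rewrite sumr_const card_subspaceC -/n -[_ *+ (_ - _)]mulr_natr natrB ?leq_pexp2l ?dimvS ?subvf 1?ltnW //.
rewrite qU ?dimvS ?subvf // dE nE gauss_binomSS => E.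
apply: (mulIf (nz d)); rewrite mulrAC divfK //; apply: (mulfI nzU).
by rewrite mulrCA -E [LHS]mulrC -mulrA.
Qed.

Lemma card_containing_eq U W : (\dim U <= k)%N -> \dim U = \dim W ->
  #|containing U| = #|containing W|.
Proof.
move=> Uk UW; have /eqP := card_containing Uk.
by rewrite UW -card_containing -?UW // eqr_nat => /eqP.
Qed.

(** With [u = \dim U], double counting makes the ratio of the two cardinals
    [(q^n - q^u) / (q^k - q^u)], which is at least [q^(n - k)]. *)
Lemma card_containing_ratio U W : (\dim W <= k)%N -> \dim W = (\dim U).+1 ->
  (#|F| ^ (\dim {:V} - k) * #|containing W| <= #|containing U|)%N.
Proof.
set n := \dim {:V}; move=> Wk WU; have q1 : (1 < #|F|)%N := card_finNzRing_gt1 F.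
have := sum_card_containing U.
rewrite (eq_bigr (fun=> #|containing W|)); last first.
  move=> x xU; have dimUx := dim_add_line xU.
  by apply: card_containing_eq; rewrite dimUx -WU.
rewrite sum_nat_const card_subspaceC -/n => E; have lt_qk : (#|F| ^ \dim U < #|F| ^ k)%N by rewrite ltn_exp2l // -WU.
rewrite -(@leq_pmul2r (#|F| ^ k - #|F| ^ \dim U)) ?subn_gt0 // -E.
rewrite mulnAC leq_mul2r mulnBr -expnD subnK // leq_sub2l ?orbT //.
by rewrite leq_pmull // expn_gt0 ltnW.
Qed.

End Containing.
End Subspaces.

(** * Cross-[t]-intersecting families of [k]-spaces *)

Section CrossIntersecting.
Variables (F : finFieldType) (V : vectType F) (k t : nat).
Hypothesis kn : (k <= \dim {:V})%N.
Hypothesis tk : (t < k)%N.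

Let q := #|F|.

Lemma card_cross_intersecting (A B : {set qkneser_vertex V k}) (W : {vspace V}) :
  \dim W = t.+1 -> B != set0 ->
  {in A & B, forall a b, t <= \dim (val a :&: val b)}%N ->
  (forall U, \dim U = t -> ~~ (B \subset containing k U)) ->
  (#|A| <= (q ^ (k - t + 1)) ^ t.+1 * #|containing k W|)%N.
Proof.
move=> dimW /set0Pn[b0 b0B] AB nocommon.
(* Some [b] in [B] satisfies [dim (U :&: b) < t] as long as [dim U <= t], so
   [card_containing_step] applies up to dimension [t.+1]. *)
suff claim d (U : {vspace V}) : (\dim U + d)%N = t.+1 ->
    (#|A :&: containing k U| <= (q ^ (k - t + 1)) ^ d * #|containing k W|)%N.
  rewrite (_ : A = A :&: containing k 0%VS) ?claim ?dimv0 //.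
  by apply/esym/setIidPl/subsetP=> a _; rewrite inE sub0v.
elim: d U => [|d IHd] U dimU.
  have UW : \dim U = \dim W by lia.
  rewrite expn0 mul1n -(card_containing_eq kn _ UW) ?UW ?dimW //.
  exact: subset_leq_card (subsetIr _ _).
have [b bB Ubt] : exists2 b, b \in B & (\dim (U :&: val b) < t)%N.
  have [ltUt|geUt] := ltnP (\dim U) t.
    by exists b0 => //; apply: leq_ltn_trans ltUt; rewrite dimvS ?capvSl.
  have Ut : \dim U = t by lia.
  have /subsetPn[b bB] := nocommon U Ut; rewrite inE => Ub; exists b => //.
  by rewrite -Ut (ltn_leqif (dimv_leqif_sup (capvSl _ _))) subv_cap subvv.
rewrite expnS -mulnA; apply: (@card_containing_step _ _ _ t _ _ _ b) => //.
- exact: ltnW.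
- by move=> a aA; apply: AB.
- by move=> x xU; apply: IHd; rewrite dim_add_line // addSn -addnS.
Qed.

Hypothesis nbig : (2 * t * (k - t + 1) + k + 1 <= \dim {:V})%N.
Hypothesis t0 : (0 < t)%N.

(** The bound on the dimension n enters through the factor [q^(n - k)] of [card_containing_ratio],
    which absorbs [2 * q^((k - t + 1)(t + 1))] when [B] has no common [t]-space and
    [4 * q^(k - t + 1)] when it has one. *)
Lemma cross_intersecting_unbalanced (A B : {set qkneser_vertex V k})
    (U0 : {vspace V}) :
  \dim U0 = t -> [disjoint A & B] ->
  {in A & B, forall a b, t <= \dim (val a :&: val b)}%N ->
  (#|containing k U0| < #|A| + #|B|)%N ->
  (4 * #|A| <= #|containing k U0|)%N || (4 * #|B| <= #|containing k U0|)%N.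
Proof.
set m := #|containing k U0| => dimU0.
wlog leBA : A B / (#|B| <= #|A|)%N.
  move=> wl dAB AB ltm; have [leBA|/ltnW leAB] := leqP #|B| #|A|; first exact: wl.
  rewrite orbC; apply: wl; rewrite // 1?disjoint_sym 1?addnC //.
  by move=> b a bB aA; rewrite capvC AB.
move=> dAB AB ltm; apply/orP; right; rewrite leqNgt; apply/negP => ltB.
have [W _ dimW] : exists2 W : {vspace V}, (W <= fullv)%VS & \dim W = t.+1.
  by apply: exists_subspace; apply: leq_trans kn.
have leNm : (q ^ (\dim {:V} - k) * #|containing k W| <= m)%N.
  by apply: card_containing_ratio; rewrite ?dimW ?dimU0.
have q1 : (1 < q)%N := card_finNzRing_gt1 F.
have leq_qq d e : (d <= e)%N -> (q ^ d <= q ^ e)%N by rewrite leq_exp2l.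
have q2 : (2 <= q ^ 1)%N by rewrite expn1.
have q4 : (4 <= q ^ 2)%N by rewrite -[4%N]/(2 ^ 2)%N leq_exp2r.
have ltA : (m < 2 * #|A|)%N by lia.
have B0 : B != set0 by apply/negP=> /eqP B0; move: ltB; rewrite B0 cards0.
have [U dimU BU] : exists2 U : {vspace V}, \dim U = t & B \subset containing k U.
  suff: [exists (U : {vspace V} | \dim U == t), B \subset containing k U].
    by case/exists_inP=> U /eqP; exists U.
  apply: contraT; rewrite negb_exists_in => /forall_inP noU.
  have := card_cross_intersecting dimW B0 AB (fun U dimU => noU U (introT eqP dimU)).
  rewrite leqNgt => /negP[]; rewrite -(ltn_pmul2l (isT : 0 < 2)%N).
  apply: leq_ltn_trans ltA; apply: leq_trans leNm; rewrite mulnA leq_mul2r.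
  apply/orP; right; rewrite -expnM; apply: leq_trans (leq_mul q2 (leqnn _)) _.
  by rewrite -expnD leq_qq //; nia.
(* If [U] were common to [A] as well, disjointness would bound [#|A| + #|B|] by m. *)
have [AU|/subsetPn[a aA]] := boolP (A \subset containing k U).
  have /eqP cardAB : #|A :|: B| == (#|A| + #|B|)%N by rewrite (leq_card_setU A B).
  move: ltm; apply/negP; rewrite -leqNgt -cardAB /m.
  rewrite (@card_containing_eq _ _ _ kn U0 U) ?dimU0 ?dimU ?(ltnW tk) //.
  by rewrite subset_leq_card // subUset AU.
rewrite inE => Ua; move: ltB; apply/negP; rewrite -leqNgt.
apply: leq_trans leNm.
(* A single step, from [U] to dimension [t.+1], with the element [a] of [A] restricting the members
   of [B]. *)
have := @card_containing_step _ _ _ t #|containing k W| B U a (ltnW tk).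
rewrite (setIidPl BU) => step; apply: leq_trans (leq_mul (leqnn 4) (step _ _ _)) _.
- by rewrite -[X in (_ < X)%N]dimU (ltn_leqif (dimv_leqif_sup (capvSl _ _))) subv_cap subvv.
- by move=> b bB; rewrite capvC AB.
- move=> x xU; apply: leq_trans (subset_leq_card (subsetIr _ _)) _.
  by rewrite (@card_containing_eq _ _ _ kn _ W) // dim_add_line ?dimU.
rewrite mulnA leq_mul2r; apply/orP; right.
apply: leq_trans (leq_mul q4 (leqnn _)) _.
by rewrite -expnD leq_qq //; nia.
Qed.

End CrossIntersecting.

(** * The treewidth of the generalized [q]-Kneser graph *)

(** Exchange a line of [U] for a line outside [v]: the new space meets [v] in a hyperplane of [v],
    of dimension [k - 1 >= t]. This supplies the non-neighbour required by [treewidth_le_star]. *)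
Lemma exists_other_vertex (F : finFieldType) (V : vectType F) (k t : nat)
    (U : {vspace V}) (v : qkneser_vertex V k) :
  (t < k)%N -> (k < \dim {:V})%N -> (0 < \dim U)%N -> (U <= val v)%VS ->
  exists2 u : qkneser_vertex V k, ~~ (U <= val u)%VS &
    (u != v) && (t <= \dim (val v :&: val u))%N.
Proof.
move=> tk kn U0 Uv; pose x := vpick U.
have xU : x \in U := memv_pick U.
have x0 : x != 0 by rewrite vpick0 -dimv_eq0 -lt0n.
have /subvPn[z _ zv] : ~~ (fullv <= val v)%VS.
  by apply: contraL kn => /dimvS; rewrite dim_vertex -leqNgt.
pose H := (val v :\: <[x]>)%VS.
have Hv : (H <= val v)%VS := diffvSl _ _.
have dimH : (\dim H).+1 = k.
  have := dimv_cap_compl (val v) <[x]>; rewrite dim_vertex.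
  by rewrite (capv_idPr _) ?dim_vline ?x0 // -memvE (subvP Uv).
have zH : z \notin H by apply: contra zv; apply: (subvP Hv).
have dimHz : \dim (H + <[z]>) == k by rewrite dim_add_line // dimH.
have uv : (val v :&: (H + <[z]>) <= H)%VS.
  apply/subvP=> y; rewrite memv_cap => /andP[yv /memv_addP[h hH [_ /vlineP[a ->] yE]]].
  suff a0 : a = 0 by rewrite yE a0 scale0r addr0.
  apply: contraNeq zv => a0; rewrite -[z](scalerK a0) memvZ //.
  have -> : a *: z = y - h by rewrite yE addrAC subrr add0r.
  by rewrite rpredB // (subvP Hv).
have xHz : ~~ (U <= H + <[z]>)%VS.
  apply: contra x0 => /subvP/(_ x xU) xu.
  rewrite -memv0 -(capv_diff (val v) <[x]>) memv_cap memv_line andbT.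
  by rewrite (subvP uv) // memv_cap xu (subvP Uv).
exists (Sub (H + <[z]>)%VS dimHz); rewrite //=; apply/andP; split.
  by apply: contraNneq xHz => /(congr1 val) /= ->.
apply: (@leq_trans (\dim H)); first by rewrite -ltnS dimH.
by rewrite dimvS // subv_cap Hv addvSl.
Qed.

Unset Implicit Arguments.

Theorem theorem1p2 (q : nat) (F : finFieldType) (V : vectType F) (n k t : nat)
  (hq : #|F| = q) (hV : \dim {:V} = n)
  (ht : (1 <= t)%N) (hk : (t < k)%N)
  (hn : (2 * t * (k - t + 1) + k + 1 <= n)%N) :
  (treewidth (qkneser V k t))%:~R
    = gauss_binom q n k - gauss_binom q (n - t) (k - t) - 1 :> rat.
Proof.
subst q n; have kn : (k < \dim {:V})%N by lia.
have [U _ dimU] : exists2 U : {vspace V}, (U <= fullv)%VS & \dim U = t.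
  by apply: exists_subspace; lia.
set G := qkneser V k t; pose I : {set G} := containing k U.
(* The case [u = v] agrees because [t < k]. *)
have nadjE (u v : G) : (~~ adj u v) = (t <= \dim (val u :&: val v))%N.
  rewrite /= /qkneser_adj negb_and negbK -leqNgt orb_idl // => /eqP->.
  by rewrite capvv dim_vertex ltnW.
suff -> : treewidth G = (#|G| - #|I|)%N%:Z - 1.
  (* The total number of vertices is the count of [k]-spaces containing the zero subspace. *)
  have card_G : #|G| = #|containing k (0%VS : {vspace V})|.
    by apply: eq_card => W; rewrite !inE sub0v.
  by rewrite intrB -pmulrn natrB ?max_card // card_G !card_containing ?dimv0 ?dimU
    ?(ltnW kn) ?(ltnW hk) // !subn0.
apply/eqP; rewrite eq_le; apply/andP; split.
  apply: treewidth_le_star => [u v|v].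
    rewrite !inE => Uu Uv; rewrite nadjE -dimU dimvS //; by rewrite subv_cap Uu.
  rewrite inE => Uv.
  have U0 : (0 < \dim U)%N by rewrite dimU.
  have [u uU /andP[uv tvu]] := exists_other_vertex hk kn U0 Uv.
  by exists u; rewrite ?inE // uv nadjE.
have [[D <-] _] := treewidthP G.
have [|s sm] := @exists_large_bag G D #|I|.
  move=> A B dAB AB; apply: (cross_intersecting_unbalanced (ltnW kn) hk) => //.
  by move=> a b aA bB; rewrite -nadjE AB.
rewrite /width lerD2r lez_nat; apply: leq_trans sm _.
exact: (@leq_bigmax_cond _ _ (fun s => #|td_bag s|)).
Qed.
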